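(* For any integer $p\ge1$ and any deterministic algorithm $\mathsf A$ (in the incremental higher-order oracle model), and for any $n$, $\Delta$, $L_p$ and $\varepsilon$, there exists a function $F\in\mathcal F_p^n(\Delta,L_p)$ such that $$T_\varepsilon(\mathsf A,F)\ \ge\ \Omega\left(\left(\frac{L_p}{\ell_p}\right)^{1/p}\frac{\Delta\, n}{\varepsilon^{(p+1)/p}}\right),$$ where the constant factors hidden by $\Omega$ do not depend on $n$, $\varepsilon$ or $p$, and $\ell_p$ is a quantity depending only on $p$ with $\ell_p\le\exp\left(\tfrac52 p\log p+cp\right)$ for some constant $c<\infty$. Moreover, the dimension of the domain of this function merely needs to be of the same order as the lower bound $\left(\frac{L_p}{\ell_p}\right)^{1/p}\frac{\Delta n}{\varepsilon^{(p+1)/p}}$.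
   Context: Here $n\ge1$ is an integer and $\Delta,L_p,\varepsilon>0$. Throughout, $\|\cdot\|$ is the tensor operator norm (Euclidean norm for vectors, spectral norm for matrices). Function class. $F\in\mathcal F_p^n(\Delta,L_p)$ if for some $d$, $F:\mathbb R^d\to\mathbb R$, $F(\mathbf x)=\frac1n\sum_{i=1}^n f_i(\mathbf x)$ (the components $f_i$ being part of the data), where (i) each $f_i$ is $p$ times continuously differentiable and $\|\nabla^p f_i(\mathbf x)-\nabla^p f_i(\mathbf y)\|\le L_p\|\mathbf x-\mathbf y\|$ for all $\mathbf x,\mathbf y$; and (ii) $F(\mathbf 0)-\inf_{\mathbf x}F(\mathbf x)\le\Delta$. Oracle and algorithms (incremental higher-order oracle model). For an arbitrary order $q$, the oracle for $F$ maps $(i,\mathbf x)\in[n]\times\mathbb R^d$ to $\nabla^{(0:q)}f_i(\mathbf x)$, the collection of the value and all derivative tensors of $f_i$ at $\mathbf x$ of orders up to $q$ (the oracle is considered for functions for which these derivatives exist). An algorithm $\mathsf A$ has access to an infinite sequence of random bits $\xi\sim\mathcal U([0,1])$ drawn at the beginning (for a deterministic algorithm the sequence is fixed) and consists of a sequence of mappings $A^{(t)}$, $t\in\mathbb N$, producing indices $i^t\in[n]$ and iterates $\mathbf x^{(t)}\in\mathbb R^d$ from previous oracle responses: $$[i^t,\mathbf x^{(t)}]=A^{(t)}\{\xi,\,i^{0:t-1},\,\mathbf x^{(0:t-1)},\,\nabla^{(0:q)}f_{i^0}(\mathbf x^{(0)}),\dots,\nabla^{(0:q)}f_{i^{t-1}}(\mathbf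 x^{(t-1)})\},$$ with $\mathbf x^{(0)}=\mathbf 0$ and no restriction on how $i^0$ is chosen. An algorithm can be run on functions of any dimension $d$. Complexity. $T_\varepsilon(\mathsf A,F)$ is the infimum over all $t\in\mathbb N$ such that the event ''$\|\nabla F(\mathbf x^{(s)})\|>\varepsilon$ for all $s\le t$'' has probability at most $\frac12$, where $\mathbf x^{(s)}$ are the iterates of $\mathsf A$ run on $F$.
   Formalization: The bound is claimed only for ε small: (L_p/ℓ_p)^{1/p} Δ/ε^{(p+1)/p} ≥ K, K an absolute constant; for all ε it fails: if p=1 and ε² > 2L_1Δ, every F has ‖∇F(0)‖ ≤ ε, so T_ε = 0 while the rate is positive. *)

(* Defs.v *)
From HB Require Import structures.
From mathcomp Require Import all_boot all_order all_algebra.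
From mathcomp Require Import all_classical all_reals all_analysis.

Set Implicit Arguments.
Unset Strict Implicit.
Unset Printing Implicit Defensive.

Import Order.TTheory GRing.Theory Num.Theory.
Import numFieldNormedType.Exports.

Local Open Scope classical_set_scope.
Local Open Scope ring_scope.

(* The library norm on 'rV[R]_d is the sup norm, which has the right topology
   but not the right constants; hence a separate Euclidean norm. *)
Definition enorm (R : realType) (d : nat) (v : 'rV[R]_d) : R :=
  Num.sqrt (\sum_i v 0 i ^+ 2).

(* A k-tensor is the k-ary form (v_1, ..., v_k) |-> T[v_1, ..., v_k]. *)
Definition tensor (R : realType) (d k : nat) : Type :=
  k.-tuple 'rV[R]_d -> R.

(* Extended-real valued, so that an unbounded form has norm +oo and not the
   default value of a real supremum. *)
Definition opnorm (R : realType) (d k : nat) (T : tensor R d k) : \bar R :=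
  ereal_sup [set (`|T v|)%:E | v in [set v : k.-tuple 'rV[R]_d |
                                      forall i, enorm (tnth v i) <= 1]].

(* nabla k f x [v_1, ..., v_k] = D_{v_1} (... (D_{v_k} f)) (x). *)
Definition nabla (R : realType) (d k : nat) (f : 'rV[R]_d -> R)
    (x : 'rV[R]_d) : tensor R d k :=
  fun v => foldr (fun w (g : 'rV[R]_d -> R) => 'D_w g) f v x.

(* k times Frechet differentiable everywhere: since 'rV[R]_d is
   finite-dimensional, x |-> 'd f x is k times differentiable iff every
   x |-> 'd f x w = 'D_w f x is. *)
Fixpoint times_differentiable (R : realType) (d k : nat)
    (f : 'rV[R]_d -> R) : Prop :=
  if k is k'.+1 then
    (forall x, differentiable f x) /\
    (forall w, times_differentiable k' ('D_w f))
  else True.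

Definition times_continuously_differentiable (R : realType) (d k : nat)
    (f : 'rV[R]_d -> R) : Prop :=
  times_differentiable k f /\
  (forall v : k.-tuple 'rV[R]_d, continuous (fun x => nabla f x v)).

Definition average (R : realType) (d n : nat)
    (f : 'I_n -> 'rV[R]_d -> R) : 'rV[R]_d -> R :=
  fun x => n%:R^-1 * \sum_i f i x.

Definition function_class (R : realType) (p n d : nat) (Delta Lp : R)
    (f : 'I_n -> 'rV[R]_d -> R) : Prop :=
  (forall i, times_continuously_differentiable p (f i) /\
     forall x y, (opnorm (fun v : p.-tuple 'rV[R]_d =>
                            (nabla (f i) x v - nabla (f i) y v)%R)
                  <= (Lp * enorm (x - y))%:E)%E) /\
  ((average f 0)%:E - ereal_inf [set (average f x)%:E | x in setT]
   <= Delta%:E)%E.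

Definition response (R : realType) (d q : nat) : Type :=
  forall k : 'I_q.+1, tensor R d k.

Definition oracle (R : realType) (d n q : nat) (f : 'I_n -> 'rV[R]_d -> R)
    (i : 'I_n) (x : 'rV[R]_d) : response R d q :=
  fun k => nabla (f i) x.

(* The random bits are encoded by one real number. *)
Variant seeding (R : realType) := Uniform01 | Fixed of R.
Arguments Uniform01 {R}.

Definition seed_law (R : realType) (s : seeding R) : set R -> \bar R :=
  match s with
  | Uniform01 => uniform_prob (@ltr01 R)
  | Fixed xi => \d_xi
  end.

(* query xi h is A^(t), with t = size h, applied to the seed xi and to the list
   h of the t earlier triples (index, iterate, oracle response), oldest first.
   The same algorithm runs in every dimension, so d is an argument of
   query. *)
Record algorithm (R : realType) (n q : nat) := Algorithm {
  seed : seeding R;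
  query : forall d : nat,
    R -> seq ('I_n * 'rV[R]_d * response R d q) -> 'I_n * 'rV[R]_d;
  query_nil : forall (d : nat) (xi : R), (@query d xi [::]).2 = 0 }.

Definition deterministic (R : realType) (n q : nat)
    (A : algorithm R n q) : Prop :=
  exists xi : R, seed A = Fixed xi.

Fixpoint transcript (R : realType) (d n q : nat) (A : algorithm R n q)
    (f : 'I_n -> 'rV[R]_d -> R) (xi : R) (t : nat) :
    seq ('I_n * 'rV[R]_d * response R d q) :=
  if t is t'.+1 then
    let h := transcript A f xi t' in
    let ix := query A xi h in
    rcons h (ix, @oracle R d n q f ix.1 ix.2)
  else [::].

Definition iterate (R : realType) (d n q : nat) (A : algorithm R n q)
    (f : 'I_n -> 'rV[R]_d -> R) (xi : R) (t : nat) : 'rV[R]_d :=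
  (query A xi (transcript A f xi t)).2.

(* T_eps(A, F); the value is +oo when no t qualifies. *)
Definition complexity (R : realType) (d n q : nat) (eps : R)
    (A : algorithm R n q) (f : 'I_n -> 'rV[R]_d -> R) : \bar R :=
  ereal_inf [set (t%:R)%:E | t in [set t : nat |
    (seed_law (seed A)
       [set xi : R | forall s : nat, (s <= t)%N ->
          (eps%:E < opnorm (@nabla R d 1 (average f) (iterate A f xi s)))%E]
     <= (2^-1)%:E)%E]].

(* (Lp / ell_p)^(1/p) * Delta * n / eps^((p+1)/p) *)
Definition rate (R : realType) (p n : nat) (Delta Lp eps ell_p : R) : R :=
  (Lp / ell_p) `^ (p%:R^-1) *
  (Delta * n%:R / eps `^ ((p.+1)%:R / p%:R)).

(* Main.v *)
Require Import Defs.
From HB Require Import structures.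
From mathcomp Require Import all_boot all_order all_algebra.
From mathcomp Require Import all_classical all_reals all_analysis.
From mathcomp Require Import ring lra zify.

Set Implicit Arguments.
Unset Strict Implicit.
Unset Printing Implicit Defensive.

Import Order.TTheory GRing.Theory Num.Theory.
Import numFieldNormedType.Exports.

Local Open Scope classical_set_scope.
Local Open Scope ring_scope.

(** The hard function is a chain of links between the coordinates
    [y_0 = 1, y_1, ..., y_T] of [x] along adaptively chosen orthogonal vectors
    [u_1, ..., u_T]: link [j] is a function of [y_j] and [y_j.+1] that vanishes
    with all its derivatives as long as [|y_j| <= 1/2], and that has a slope in
    [y_j.+1] bounded away from 0 when [|y_j| >= 1] and [|y_j.+1| < 1].  Hence a
    point with [y_T = 0] has a large gradient ([opnorm_grad_dchain]): look at the
    first [j] with [|y_j.+1| < 1].  Each link is present in about half of the [n]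
    components only, so the average is about half of the full chain, while each
    component has the smoothness of a full chain.

    The adversary ([resisting_oracle]) answers the queries in blocks of about
    [n / 2].  Link [k] goes to components that are not asked, except possibly by
    the last query, in block [k], and [u_k.+1] is orthogonal to all iterates
    up to the end of that block.  In earlier blocks [y_k] vanishes at all
    iterates, so that link [k] is closed: no answer depends on it, whatever the
    order of the oracle.  Consequently [y_T] vanishes at the first
    [T * (n / 2 + 1)] iterates, and all of them have gradient above [eps].

    The links are built from [exp (- 1 / y)] and the sine.  The derivatives of
    order [k] of the former are at most [2 ^ k * (2 k)!] ([dflat_bound]), by an
    induction over the family [y ^ (- j) * exp (- 1 / y)].  Along [p + 1]
    directions the derivative of one link is bounded by [p + 1] weight factors,
    and since [p + 1 >= 2] the Cauchy-Schwarz and Bessel inequalities bound the sum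
    over all links independently of [T] ([dchain_bound]).  This gives
    [ell_p = exp (2 p ln p + O(p))].  Scaling the lengths by [sigma] and the
    values by [2 * eps * sigma] puts the gradients above [eps] and makes the
    Lipschitz constant at most [Lp]; then [Delta] pays for [T] of order
    [Delta / (eps * sigma)], which is the rate divided by [n]. *)

(** * A flat function and its derivatives *)

Section Flat.
Context {R : realType}.
Implicit Types (x y z : R) (j k : nat).

(** [flat j x] is [x^-j * exp (- 1 / x)] for positive [x], and 0 otherwise.
    Allowing all powers of [1 / x] makes the family closed under
    differentiation. *)
Definition flat j x : R := if 0 < x then x ^- j * expR (- x^-1) else 0.

Lemma flat_le0 j x : x <= 0 -> flat j x = 0.
Proof. by rewrite /flat leNgt => /negbTE ->. Qed.

Lemma flat_ge0 j x : 0 <= flat j x.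
Proof.
rewrite /flat; case: ifP => // x0.
by rewrite mulr_ge0 ?expR_ge0// invr_ge0 exprn_ge0 // ltW.
Qed.

Lemma flat_scale j x : flat j x = x * flat j.+1 x.
Proof.
rewrite /flat; case: ifP => [x0|_]; last by rewrite mulr0.
by rewrite exprS invfM !mulrA mulfV ?mul1r // gt_eqF.
Qed.

Lemma flat_le_fact j x : flat j x <= j`!%:R.
Proof.
rewrite /flat; case: ifP => [x0|_]; last exact: ler0n.
have y0 : 0 < x^-1 by rewrite invr_gt0.
rewrite -exprVn expRN ler_pdivrMr ?expR_gt0//.
case: j => [|j]; first by rewrite expr0 fact0 mul1r -expR0 ler_expR ltW.
have := expR_ge1Dxn j (ltW y0).
have f0 : (0 : R) < (j.+1)`!%:R by rewrite ltr0n fact_gt0.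
move=> h; rewrite -ler_pdivrMl// mulrC; apply: le_trans h.
by rewrite lerDr.
Qed.

Lemma flat0_nondecreasing : {homo flat 0 : x y / x <= y}.
Proof.
move=> x y xy; case: (ltP 0 x) => x0; last by rewrite (flat_le0 _ x0) flat_ge0.
have y0 := lt_le_trans x0 xy.
by rewrite /flat x0 y0 !expr0 !invr1 !mul1r ler_expR lerN2 lef_pV2.
Qed.

Lemma is_derive_flat j x :
  is_derive x 1 (flat j) (flat j.+2 x - j%:R * flat j.+1 x).
Proof.
case: (ltgtP x 0) => x0.
- rewrite !flat_le0 ?(ltW x0)// mulr0 subr0.
  apply: (@near_eq_is_derive _ _ _ (cst 0)).
    near=> z; rewrite /= flat_le0// ltW//.
    by near: z; exact: lt_nbhsl.
- rewrite /flat x0.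
  apply: (@near_eq_is_derive _ _ _ (fun z => z ^- j * expR (- z^-1))).
    near=> z; suff -> : 0 < z by [].
    by near: z; exact: lt_nbhsr.
  have xn0 : x != 0 by rewrite gt_eqF.
  have xjn0 : x ^+ j != 0 by rewrite expf_neq0.
  have Hp : is_derive x 1 (fun z : R => z ^+ j) (j%:R * x ^+ j.-1 *: (1 : R)).
    have -> : (fun z : R => z ^+ j) = (id : R -> R) ^+ j.
      by apply/funext => z; rewrite exprfctE.
    exact: is_deriveX.
  have H1 := @is_deriveV _ (fun z : R => z ^+ j) x _ 1 xjn0 Hp.
  have H2 : is_derive x 1 (expR \o (fun z => - z^-1))
     (expR (- x^-1) * (- (- x ^- 2 *: (1:R)))).
    apply: is_derive1_comp.
    apply: is_deriveN.
    exact: (@is_deriveV _ id x 1 1 xn0 (is_derive_id x 1)).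
  apply: is_derive_eq (is_deriveM H1 H2) _.
  rewrite /= /GRing.scale/= !mulr1 opprK.
  set e := expR _.
  case: j {Hp H1 H2 xjn0} => [|j] /=; rewrite ?exprS; field => //=.
  by rewrite xn0 expf_neq0.
- rewrite x0 !flat_le0// mulr0 subr0.
  have Habs : (fun h : R => `|h| * (j.+2)`!%:R) @ 0^' --> (0 : R).
    have : (fun h : R => `|h| * (j.+2)`!%:R) @ 0^' --> `|0 : R| * (j.+2)`!%:R.
      apply: cvgMr_tmp; apply: cvg_within_filter; apply: cvg_norm.
      exact: cvg_id.
    by rewrite normr0 mul0r.
  have H : (fun h : R => h^-1 *: ((flat j \o shift 0) (h *: 1) - flat j 0))
             @ 0^' --> (0 : R).
    apply: (@squeeze_cvgr _ _ _ _ (fun h => - (`|h| * (j.+2)`!%:R))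
        (fun h => `|h| * (j.+2)`!%:R)).
    + near=> h.
      have -> : (flat j \o shift 0) (h *: 1) = flat j h.
        by rewrite /= addr0 /GRing.scale/= mulr1.
      have h0 : h != 0 by near: h; exact: nbhs_dnbhs_neq.
      rewrite (flat_le0 _ (lexx 0)) subr0 flat_scale flat_scale.
      rewrite /GRing.scale/= mulKf//.
      rewrite -ler_norml normrM ler_wpM2l//.
      by rewrite ger0_norm ?flat_ge0// flat_le_fact.
    + by have := cvgN Habs; rewrite oppr0; apply.
    + exact: Habs.
  apply: DeriveDef; first by apply/cvg_ex; exists 0.
  exact/cvg_lim.
Unshelve. all: by end_near. Qed.

(** The [k]-th derivative of [flat j]. *)
Fixpoint dflat k j x : R :=
  if k is k'.+1 then dflat k' j.+2 x - j%:R * dflat k' j.+1 x else flat j x.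

Lemma is_derive_dflat k j x : is_derive x 1 (dflat k j) (dflat k.+1 j x).
Proof.
elim: k j => [|k IH] j; first exact: is_derive_flat.
have H := is_deriveB (IH j.+2) (is_deriveZ j%:R (IH j.+1)).
exact: H.
Qed.

Lemma dflat_le0 k j x : x <= 0 -> dflat k j x = 0.
Proof.
elim: k j => [|k IH] j x0 /=; first exact: flat_le0.
by rewrite !IH// mulr0 subr0.
Qed.

Lemma dflat_bound k j x : `|dflat k j x| <= 2 ^+ k * (j + 2 * k)`!%:R.
Proof.
elim: k j => [|k IH] j /=.
  by rewrite expr0 mul1r muln0 addn0 ger0_norm ?flat_ge0 ?flat_le_fact.
apply: (le_trans (ler_normB _ _)); rewrite exprS -mulrA mulrDl mul1r.
have e2 : (j + 2 * k.+1 = j.+2 + 2 * k)%N by rewrite mulnS !addSn !addnS addnA.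
apply: lerD; first by rewrite e2; exact: IH.
rewrite normrM normr_nat.
apply: (le_trans (ler_wpM2l (ler0n _ _) (IH j.+1))).
rewrite mulrCA ler_wpM2l ?exprn_ge0// -natrM ler_nat.
by rewrite e2 addSn factS leq_mul// -addSn leqW// leqW// leq_addr.
Qed.

End Flat.

Section Trig.
Context {R : realType}.

(** The [k]-th derivative of the sine. *)
Definition dsin (k : nat) (x : R) : R := sin (x + k%:R * (pi / 2)).

Lemma is_derive_dsin k (x : R) : is_derive x 1 (dsin k) (dsin k.+1 x).
Proof.
have H1 : is_derive x 1 (fun x : R => x + k%:R * (pi / 2)) (1 + 0).
  by apply: is_deriveD.
have H := is_derive1_comp (is_derive_sin _) H1.
apply: is_derive_eq H _.
rewrite addr0 mulr1 /dsin -[k.+1%:R]natr1.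
by rewrite (mulrDl k%:R 1) mul1r addrA sinDpihalf.
Qed.

Lemma dsin_le1 k (x : R) : `|dsin k x| <= 1.
Proof. by rewrite ler_norml sin_geN1 sin_le1. Qed.

Lemma dsin0 (x : R) : dsin 0 x = sin x.
Proof. by rewrite /dsin mul0r addr0. Qed.

Lemma dsin1 (x : R) : dsin 1 x = cos x.
Proof. by rewrite /dsin mul1r sinDpihalf. Qed.

End Trig.

(** * The link function *)

Section Link.
Context {R : realType}.
Implicit Types (y z : R) (a b : nat).

(** The normalisation makes [gate_amp * flat 0 (1 / 2) * cos 1] equal to 2. *)
Definition gate_amp : R := 2 / (flat 0 2^-1 * cos 1).

(** With the gate [G y = gate_amp * flat 0 (y - 1 / 2)], the link is
    [G (- y) * (1 - sin z) - G y * (1 + sin z)], and [dlink a b] is its partial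
    derivative of order [a] in [y] and [b] in [z].  The term [(b == 0)%:R] is the
    [b]-th derivative of the constant 1. *)
Definition dlink a b y z : R :=
  gate_amp * (dflat a 0 (y - 2^-1) * (- (b == 0%N)%:R - dsin b z)
     + (-1) ^+ a * dflat a 0 (- y - 2^-1) * ((b == 0%N)%:R - dsin b z)).

Lemma flat0_half_gt0 : 0 < flat 0 (2^-1 : R).
Proof. by rewrite /flat invr_gt0 ltr0n /= expr0 invr1 mul1r expR_gt0. Qed.

Lemma gate_amp_gt0 : 0 < gate_amp.
Proof. by rewrite divr_gt0 // mulr_gt0 ?flat0_half_gt0 ?cos1_gt0. Qed.

(** The link and all its partial derivatives vanish when its first argument
    is at most 1/2 in absolute
    value: the gate is closed. *)
Lemma dlink_eq0 a b y z : `|y| <= 2^-1 -> dlink a b y z = 0.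
Proof.
rewrite ler_norml => /andP[y1 y2].
rewrite /dlink !dflat_le0 ?subr_le0//; last by rewrite lerNl.
by rewrite mulr0 !mul0r addr0 mulr0.
Qed.

(** Each of the two products in [dlink] is at most [2 ^ k * (2 k)! * 2]. *)
Lemma dlink_bound k a b y z : (a <= k)%N ->
  `|dlink a b y z| <= 4 * gate_amp * (2 ^+ k * (2 * k)`!%:R).
Proof.
move=> ak.
set B := 2 ^+ k * _.
have HB t : `|dflat a 0 t| <= B.
  apply: (le_trans (dflat_bound _ _ _)); rewrite add0n /B.
  apply: ler_pM => //.
    by rewrite ler_weXn2l // ler1n.
  by rewrite ler_nat leq_fact // leq_mul2l.
have HS (e : R) : `|e| <= 1 -> `|e - dsin b z| <= 2.
  move=> e1; apply: (le_trans (ler_normB _ _)).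
  have := dsin_le1 b z; lra.
have Hn (n : bool) : `|n%:R| <= 1 :> R by case: n; rewrite ?normr1 ?normr0.
rewrite /dlink normrM (gtr0_norm gate_amp_gt0).
have -> : 4 * gate_amp * B = gate_amp * (4 * B) by ring.
apply: ler_wpM2l; first exact: ltW gate_amp_gt0.
apply: (le_trans (ler_normD _ _)).
have -> : 4 * B = B * 2 + B * 2 by ring.
apply: lerD; rewrite normrM; apply: ler_pM => //.
- by apply: HS; rewrite normrN.
- by rewrite normrM normrX normrN normr1 expr1n mul1r.
- exact: HS.
Qed.

Lemma link_const_ge0 k : 0 <= 4 * gate_amp * (2 ^+ k * (2 * k)`!%:R).
Proof.
apply: mulr_ge0; last by rewrite mulr_ge0 ?exprn_ge0.
by apply: mulr_ge0 => //; exact: ltW gate_amp_gt0.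
Qed.

Lemma link_ge y z : - (2 * gate_amp) <= dlink 0 0 y z.
Proof.
rewrite /dlink /= !expr0 mul1r dsin0.
have -> : - (2 * gate_amp) = gate_amp * (- 2) :> R by ring.
apply: ler_wpM2l; first exact: ltW gate_amp_gt0.
have s1 := sin_le1 z; have s2 := sin_geN1 z.
have f1 := flat_ge0 0 (y - 2^-1); have f2 := flat_ge0 0 (- y - 2^-1).
have g1 := flat_le_fact 0 (y - 2^-1).
rewrite fact0 in g1.
nra.
Qed.

Lemma link1_le0 : dlink 0 0 (1 : R) 0 <= 0.
Proof.
rewrite /dlink /= dsin0 sin0 (flat_le0 0 (_ : - 1 - 2^-1 <= 0)) ?mulr0 ?mul0r//.
  rewrite addr0 subr0 mulrN1 mulrN oppr_le0 mulr_ge0 ?flat_ge0//.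
  exact: ltW gate_amp_gt0.
Qed.

(** By this lemma and the next one, the contributions of two consecutive links
    to the slope in their shared coordinate have the same sign and do not
    cancel. *)
Lemma dlink01_le y z : 1 <= `|y| -> `|z| < 1 -> dlink 0 1 y z <= - 2.
Proof.
move=> y1 z1.
have cz : cos 1 <= cos z.
  rewrite -(cos_norm z).
  have pi1 : 1 <= pi :> R by apply: le_trans (pi_ge2 R); rewrite ler1n.
  case: (eqVneq `|z| 1) => [->//|_].
  rewrite ltW// ltr_cos// in_itv/= ?normr_ge0 ?ler01 ?pi1//=.
  by rewrite (le_trans (ltW z1)).
have c0 := @cos1_gt0 R.
have h0 := flat0_half_gt0.
have f1 := flat_ge0 0 (y - 2^-1); have f2 := flat_ge0 0 (- y - 2^-1).
have hf : flat 0 2^-1 <= flat 0 (y - 2^-1) + flat 0 (- y - 2^-1).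
  move: y1; rewrite ler_normr => /orP[y1|y1].
    apply: (le_trans (flat0_nondecreasing (_ : 2^-1 <= y - 2^-1))); lra.
  apply: (le_trans (flat0_nondecreasing (_ : 2^-1 <= - y - 2^-1))); lra.
rewrite /dlink /= dsin1 oppr0 !sub0r expr0 mul1r !mulrN -opprD mulrN lerN2.
rewrite -mulrDl.
apply: (@le_trans _ _ (gate_amp * (flat 0 2^-1 * cos 1))).
  by rewrite /gate_amp divfK// gt_eqF// mulr_gt0.
apply: ler_wpM2l; first exact: ltW gate_amp_gt0.
by apply: ler_pM => //; exact: ltW.
Qed.

Lemma dlink10_le0 y z : dlink 1 0 y z <= 0.
Proof.
have h t : 0 <= dflat 1 0 t :> R.
  by rewrite /= mul0r subr0 flat_ge0.
have s1 := sin_le1 z; have s2 := sin_geN1 z.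
have h1 := h (y - 2^-1); have h2 := h (- y - 2^-1).
rewrite /dlink eqxx dsin0 expr1.
rewrite pmulr_rle0 ?gate_amp_gt0//.
move: h1 h2; move: (dflat _ _ _) (dflat _ _ _) => p q.
rewrite (_ : true%:R = 1)// => q0 p0; nra.
Qed.

End Link.

(** * Chains of links and their derivatives *)

Section Dot.
Context {R : realType} {d : nat}.
Implicit Types u v w x : 'rV[R]_d.

Definition dot u x : R := \sum_i u 0 i * x 0 i.

Lemma dot_is_linear u : linear (dot u).
Proof.
move=> k x y; rewrite /dot scaler_sumr -big_split /=.
by apply: eq_bigr => i _; rewrite !mxE /GRing.scale /=; ring.
Qed.

HB.instance Definition _ u :=
  GRing.isLinear.Build R 'rV[R]_d R *%R (dot u) (dot_is_linear u).

Lemma dotC u v : dot u v = dot v u.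
Proof. by apply: eq_bigr => i _; rewrite mulrC. Qed.

Lemma dot0l x : dot 0 x = 0.
Proof. by rewrite dotC linear0. Qed.

Lemma dotZ k u x : dot u (k *: x) = k * dot u x.
Proof. exact: linearZ. Qed.

Lemma dotB u x y : dot u (x - y) = dot u x - dot u y.
Proof. exact: linearB. Qed.

Lemma dot_sum u (I : Type) (r : seq I) (P : pred I) (F : I -> 'rV[R]_d) :
  dot u (\sum_(i <- r | P i) F i) = \sum_(i <- r | P i) dot u (F i).
Proof. exact: linear_sum. Qed.

Lemma dotxx_ge0 x : 0 <= dot x x.
Proof. by apply: sumr_ge0 => i _; rewrite -expr2 sqr_ge0. Qed.

Lemma enorm_sqr x : enorm x ^+ 2 = dot x x.
Proof.
rewrite /enorm sqr_sqrtr; first by apply: eq_bigr => i _; rewrite expr2.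
by apply: sumr_ge0 => i _; rewrite sqr_ge0.
Qed.

Lemma enorm_ge0 x : 0 <= enorm x.
Proof. exact: sqrtr_ge0. Qed.

Lemma continuous_dot u : continuous (dot u).
Proof.
move=> x; apply: differentiable_continuous.
have -> : dot u = \sum_(i < d) (u 0 i *: (fun x : 'rV[R]_d => x 0 i)).
  by apply/funext => y; rewrite fct_sumE.
apply: differentiable_sum => i; apply: differentiableZ.
exact: differentiable_coord.
Qed.

Lemma differentiable_dot u x : differentiable (dot u) x.
Proof. exact/linear_differentiable/continuous_dot. Qed.

Lemma diff_dot u x w : 'd (dot u) x w = dot u w.
Proof. by rewrite diff_lin //; exact: continuous_dot. Qed.

(** The chain rule for ridge functions. *)
Lemma differentiable_ridge (f f' : R -> R) c u x w :
  (forall t : R, is_derive t 1 f (f' t)) ->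
  differentiable (fun x => f (c + dot u x)) x /\
  'D_w (fun x => f (c + dot u x)) x = dot u w * f' (c + dot u x).
Proof.
move=> Hf.
have Da : differentiable (fun x => c + dot u x) x.
  apply: differentiableD; first exact: differentiable_cst.
  exact: differentiable_dot.
have Df : differentiable f (c + dot u x).
  by apply/derivable1_diffP; case: (Hf (c + dot u x)).
have Dc := differentiable_comp Da Df.
split=> //; rewrite deriveE// diff_comp//=.
have -> : 'd (fun x => c + dot u x) x w = dot u w.
  rewrite (diffD (differentiable_cst _ _) (differentiable_dot u x)) /=.
  by rewrite diff_cst /= diff_dot add0r.
rewrite -[X in 'd f _ X]mulr1 linearZ -deriveE//.
by case: (Hf (c + dot u x)) => _ ->.
Qed.

End Dot.

Section Chain.
Context {R : realType} {d : nat}.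
Implicit Types (u : nat -> 'rV[R]_d) (x w : 'rV[R]_d) (s : seq 'rV[R]_d).

(** The chain coordinates: with [u 0 = 0], coordinate 0 is the constant 1,
    which opens the first gate. *)
Definition coord u j x : R := (j == 0%N)%:R + dot (u j) x.

(** [dchain1 u j s a b] is the derivative along the directions [s] of
    [dlink a b] applied to the chain coordinates [j] and [j.+1]. *)
Fixpoint dchain1 u j s a b x : R :=
  if s is w :: s' then
    dot (u j) w * dchain1 u j s' a.+1 b x + dot (u j.+1) w * dchain1 u j s' a b.+1 x
  else dlink a b (coord u j x) (coord u j.+1 x).

(** The directions are prepended, so that [dchain1] satisfies the recursion that
    defines [nabla]. *)
Lemma dchain1_diff u j s a b x w :
  differentiable (dchain1 u j s a b) x /\
  'D_w (dchain1 u j s a b) x = dchain1 u j (w :: s) a b x.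
Proof.
elim: s a b => [|w' s IH] a b.
- rewrite /= /coord.
  set c := (j == 0%N)%:R : R; set c' := (j.+1 == 0%N)%:R : R.
  pose A a x := dflat a 0 (c + dot (u j) x - 2^-1) : R.
  pose B a x := (-1) ^+ a * dflat a 0 (- (c + dot (u j) x) - 2^-1) : R.
  pose P b x := - (b == 0%N)%:R - dsin b (c' + dot (u j.+1) x) : R.
  pose Q b x := (b == 0%N)%:R - dsin b (c' + dot (u j.+1) x) : R.
  have HA : differentiable (A a) x /\ 'D_w (A a) x = dot (u j) w * A a.+1 x.
    apply: (@differentiable_ridge _ _ (fun y => dflat a 0 (y - 2^-1))
       (fun y => dflat a.+1 0 (y - 2^-1))) => t.
    have H1 : is_derive t 1 (fun y : R => y - 2^-1) (1 - 0) by apply: is_deriveB.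
    have H3 := is_derive1_comp (is_derive_dflat a 0 _) H1.
    by apply: is_derive_eq H3 _; rewrite subr0 mulr1.
  have HB : differentiable (B a) x /\ 'D_w (B a) x = dot (u j) w * B a.+1 x.
    apply: (@differentiable_ridge _ _
       (fun y => (-1) ^+ a * dflat a 0 (- y - 2^-1))
       (fun y => (-1) ^+ a.+1 * dflat a.+1 0 (- y - 2^-1))) => t.
    have H1 : is_derive t 1 (fun y : R => - y - 2^-1) (- 1 - 0).
      by apply: is_deriveB.
    have H3 := is_deriveZ ((-1) ^+ a) (is_derive1_comp (is_derive_dflat a 0 _) H1).
    apply: is_derive_eq H3 _; rewrite subr0 mulrN1 exprS /GRing.scale /=; ring.
  have HP : differentiable (P b) x /\ 'D_w (P b) x = dot (u j.+1) w * P b.+1 x.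
    apply: (@differentiable_ridge _ _
       (fun y => - (b == 0%N)%:R - dsin b y)
       (fun y => - (b.+1 == 0%N)%:R - dsin b.+1 y)) => t.
    apply: is_derive_eq (is_deriveB (is_derive_cst (- (b == 0%N)%:R : R) t 1)
      (is_derive_dsin b t)) _.
    by rewrite /= oppr0.
  have HQ : differentiable (Q b) x /\ 'D_w (Q b) x = dot (u j.+1) w * Q b.+1 x.
    apply: (@differentiable_ridge _ _
       (fun y => (b == 0%N)%:R - dsin b y)
       (fun y => (b.+1 == 0%N)%:R - dsin b.+1 y)) => t.
    exact: is_derive_eq (is_deriveB (is_derive_cst ((b == 0%N)%:R : R) t 1)
      (is_derive_dsin b t)) _.
  have -> : (fun x => dlink a b (c + dot (u j) x) (c' + dot (u j.+1) x)) =
            gate_amp *: (A a * P b + B a * Q b).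
    by apply/funext => y; rewrite !fctE.
  case: HA HB HP HQ => [A1 A2] [B1 B2] [P1 P2] [Q1 Q2].
  have AP : differentiable (A a * P b) x by exact: differentiableM.
  have BQ : differentiable (B a * Q b) x by exact: differentiableM.
  have APBQ : differentiable (A a * P b + B a * Q b) x by exact: differentiableD.
  split; first exact: differentiableZ.
  rewrite deriveZ; last exact: diff_derivable.
  rewrite deriveD; [|exact: diff_derivable|exact: diff_derivable].
  rewrite deriveM; [|exact: diff_derivable|exact: diff_derivable].
  rewrite deriveM; [|exact: diff_derivable|exact: diff_derivable].
  rewrite A2 B2 P2 Q2 /dlink -/(A a x) -/(A a.+1 x) -/(P b x) -/(P b.+1 x).
  rewrite -/(B a x) -/(B a.+1 x) -/(Q b x) -/(Q b.+1 x) /GRing.scale /=; ring.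
- have [D1 E1] := IH a.+1 b; have [D2 E2] := IH a b.+1.
  have -> : dchain1 u j (w' :: s) a b = dot (u j) w' *: dchain1 u j s a.+1 b +
      dot (u j.+1) w' *: dchain1 u j s a b.+1 by apply/funext => y.
  have Z1 := differentiableZ (dot (u j) w') D1.
  have Z2 := differentiableZ (dot (u j.+1) w') D2.
  split; first exact: differentiableD.
  rewrite deriveD; [|exact: diff_derivable|exact: diff_derivable].
  rewrite deriveZ; last exact: diff_derivable.
  rewrite deriveZ; last exact: diff_derivable.
  by rewrite E1 E2 /GRing.scale /=; ring.
Qed.

(** The derivative along [s] of the weighted sum of the first [T] links. *)
Definition dchain T (c : nat -> R) u s x : R :=
  \sum_(j < T) c j * dchain1 u j s 0 0 x.

Lemma dchain_diff T c u s x w :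
  differentiable (dchain T c u s) x /\
  'D_w (dchain T c u s) x = dchain T c u (w :: s) x.
Proof.
have E : dchain T c u s = \sum_(j < T) (c j *: dchain1 u j s 0 0).
  by apply/funext => y; rewrite fct_sumE.
have D (j : 'I_T) : differentiable (c j *: dchain1 u j s 0 0) x.
  by apply: differentiableZ; case: (dchain1_diff u j s 0 0 x w).
split; first by rewrite E; apply: differentiable_sum.
rewrite E derive_sum => [|j]; last exact: diff_derivable.
apply: eq_bigr => j _.
have [D1 E1] := dchain1_diff u j s 0 0 x w.
by rewrite deriveZ ?E1//; exact: diff_derivable.
Qed.

Lemma derive_dchain T c u s w :
  'D_w (dchain T c u s) = dchain T c u (w :: s).
Proof. by apply/funext => x; case: (dchain_diff T c u s x w). Qed.

Lemma continuous_dchain T c u s : continuous (dchain T c u s).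
Proof.
by move=> x; apply: differentiable_continuous; case: (dchain_diff T c u s x 0).
Qed.

Lemma nabla_dchain T c u k x (v : k.-tuple 'rV[R]_d) :
  nabla (dchain T c u [::]) x v = dchain T c u v x.
Proof.
rewrite /nabla; case: v => s _ /=.
suff -> : foldr (fun w (g : 'rV[R]_d -> R) => 'D_w g) (dchain T c u [::]) s
  = dchain T c u s by [].
by elim: s => //= w s ->; exact: derive_dchain.
Qed.

Lemma times_differentiable_dchain T c u k s :
  times_differentiable k (dchain T c u s).
Proof.
elim: k s => //= k IH s; split; first by move=> x; case: (dchain_diff T c u s x 0).
by move=> w; rewrite derive_dchain.
Qed.

Lemma times_continuously_differentiable_dchain T c u k :
  times_continuously_differentiable k (dchain T c u [::]).
Proof.
split; first exact: times_differentiable_dchain.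
move=> v; have -> : (fun x => nabla (dchain T c u [::]) x v) = dchain T c u v.
  by apply/funext => x; exact: nabla_dchain.
exact: continuous_dchain.
Qed.

(** A closed gate hides its link from derivatives of every order. *)
Lemma dchain1_eq0 u j s a b x : `|coord u j x| <= 2^-1 -> dchain1 u j s a b x = 0.
Proof.
move=> h; elim: s a b => [|w s IH] a b /=; first exact: dlink_eq0.
by rewrite !IH !mulr0 addr0.
Qed.

Lemma eq_dchain1 u u' j s a b x : u j = u' j -> u j.+1 = u' j.+1 ->
  dchain1 u j s a b x = dchain1 u' j s a b x.
Proof.
move=> e1 e2; elim: s a b => [|w s IH] a b /=.
  by rewrite /coord e1 e2.
by rewrite !IH e1 e2.
Qed.

End Chain.

(** * Bessel's inequality and the Lipschitz constant *)

Section FiniteSums.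
Context {R : realType}.

Lemma sum_cauchy_schwarz T (a b : 'I_T -> R) A B : 0 <= A -> 0 <= B ->
  \sum_i a i ^+ 2 <= A ^+ 2 -> \sum_i b i ^+ 2 <= B ^+ 2 ->
  \sum_i a i * b i <= A * B.
Proof.
have zero (c : 'I_T -> R) : \sum_i c i ^+ 2 <= 0 -> forall i, c i = 0.
  move=> h i; apply/eqP; rewrite -sqrf_eq0 eq_le sqr_ge0 andbT.
  apply: le_trans h; rewrite (bigD1 i)//= lerDl.
  by apply: sumr_ge0 => j _; exact: sqr_ge0.
rewrite le_eqVlt => /orP[/eqP<- _|A0].
  rewrite expr0n mul0r => /zero a0 _.
  by rewrite big1// => i _; rewrite a0 mul0r.
rewrite le_eqVlt => /orP[/eqP<- _|B0 hA hB].
  rewrite expr0n mulr0 => /zero b0.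
  by rewrite big1// => i _; rewrite b0 mulr0.
(* Weighted arithmetic-geometric mean inequality. *)
apply: (@le_trans _ _ (\sum_i (B / A / 2 * a i ^+ 2 + A / B / 2 * b i ^+ 2))).
  apply: ler_sum => i _; rewrite -subr_ge0.
  have -> : B / A / 2 * a i ^+ 2 + A / B / 2 * b i ^+ 2 - a i * b i =
     (B * a i - A * b i) ^+ 2 / (2 * A * B).
    by field; rewrite !gt_eqF.
  by rewrite divr_ge0 ?sqr_ge0// !mulr_ge0 // ltW.
rewrite big_split/= -!mulr_sumr.
have -> : A * B = B / A / 2 * A ^+ 2 + A / B / 2 * B ^+ 2.
  by field; rewrite !gt_eqF.
by apply: lerD; apply: ler_wpM2l => //; rewrite !mulr_ge0 ?invr_ge0 ?ltW.
Qed.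

End FiniteSums.

Section Lipschitz.
Context {R : realType} {d : nat}.
Implicit Types (u : nat -> 'rV[R]_d) (x y w : 'rV[R]_d) (s : seq 'rV[R]_d).

(** Pairwise orthogonal vectors [u 1], ..., [u T] of squared norm [r], preceded
    by [u 0 = 0]. *)
Definition frame T (r : R) u : Prop :=
  u 0%N = 0 /\ forall i j, (i < T)%N -> (j < T)%N ->
    dot (u i.+1) (u j.+1) = (i == j)%:R * r.

Lemma bessel T (r : R) u w : 0 < r -> frame T r u ->
  \sum_(j < T) dot (u j.+1) w ^+ 2 <= r * dot w w.
Proof.
move=> r0 [_ orth].
(* [v] is the component of [w] orthogonal to the frame. *)
pose v := w - \sum_(j < T) (dot (u j.+1) w / r) *: u j.+1.
have vu (i : 'I_T) : dot v (u i.+1) = 0.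
  rewrite dotC /v dotB dot_sum (bigD1 i)//= big1 => [|j ji].
    by rewrite addr0 dotZ orth// eqxx mul1r divfK ?subrr// gt_eqF.
  by rewrite dotZ orth// eq_sym (inj_eq val_inj) (negbTE ji) mul0r mulr0.
have vw : dot v v = dot v w.
  rewrite {2}/v dotB dot_sum big1 ?subr0// => j _.
  by rewrite dotZ vu mulr0.
have := dotxx_ge0 v; rewrite vw dotC /v dotB dot_sum.
rewrite (eq_bigr (fun j : 'I_T => r^-1 * dot (u j.+1) w ^+ 2)) => [|j _].
  by rewrite -mulr_sumr subr_ge0 ler_pdivrMl.
by rewrite dotZ (dotC w) mulrAC -expr2 mulrC.
Qed.

(** The weight with which link [j] feels the direction [w]. *)
Definition wt u w j : R := `|dot (u j) w| + `|dot (u j.+1) w|.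

Lemma wt_ge0 u w j : 0 <= wt u w j.
Proof. exact: addr_ge0. Qed.

Lemma sum_wt_sqr T (sigma : R) u w : 0 < sigma -> frame T (sigma ^- 2) u ->
  \sum_(j < T) wt u w j ^+ 2 <= (2 * enorm w / sigma) ^+ 2.
Proof.
move=> s0 fr; have r0 : 0 < sigma ^- 2 by rewrite invr_gt0 exprn_gt0.
have B1 := bessel w r0 fr.
have B2 : \sum_(j < T) dot (u j) w ^+ 2 <= sigma ^- 2 * dot w w.
  apply: le_trans B1.
  have := @big_ord_recl R 0 +%R T (fun i => dot (u i) w ^+ 2).
  rewrite big_ord_recr/= (proj1 fr) dot0l expr0n add0r => <-.
  by rewrite lerDl sqr_ge0.
have -> : (2 * enorm w / sigma) ^+ 2 =
    2 * (sigma ^- 2 * dot w w) + 2 * (sigma ^- 2 * dot w w).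
  by rewrite -enorm_sqr; field; rewrite gt_eqF.
apply: (@le_trans _ _ (\sum_(j < T) (2 * dot (u j) w ^+ 2 + 2 * dot (u j.+1) w ^+ 2))).
  apply: ler_sum => j _; rewrite /wt.
  rewrite -[dot (u j) w ^+ 2]real_normK ?num_real//.
  rewrite -[dot (u j.+1) w ^+ 2]real_normK ?num_real//.
  have := sqr_ge0 (`|dot (u j) w| - `|dot (u j.+1) w|); nra.
by rewrite big_split/= -!mulr_sumr; apply: lerD; apply: ler_wpM2l.
Qed.

Lemma dchain1_bound u j s a b k x : (a + size s <= k)%N ->
  `|dchain1 u j s a b x| <=
    4 * gate_amp * (2 ^+ k * (2 * k)`!%:R) * \prod_(w <- s) wt u w j.
Proof.
elim: s a b => [|w s IH] a b /=.
  by rewrite addn0 big_nil mulr1; exact: dlink_bound.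
rewrite addnS => h; rewrite big_cons /wt.
apply: (le_trans (ler_normD _ _)).
rewrite mulrCA mulrDl !normrM.
apply: lerD; apply: ler_wpM2l => //; apply: IH => //.
by rewrite (leq_trans _ h)// leqW.
Qed.

(** Two of the factors are summed by the Cauchy-Schwarz inequality, the others
    are bounded one by one; this is why at least two directions are needed. *)
Lemma sum_prod_wt T (sigma : R) u w1 w2 s : 0 < sigma -> frame T (sigma ^- 2) u ->
  \sum_(j < T) \prod_(w <- [:: w1, w2 & s]) wt u w j <=
  \prod_(w <- [:: w1, w2 & s]) (2 * enorm w / sigma).
Proof.
move=> s0 fr.
have b0 w : 0 <= 2 * enorm w / sigma.
  by rewrite divr_ge0 ?mulr_ge0 ?enorm_ge0// ltW.
have wb (j : 'I_T) w : wt u w j <= 2 * enorm w / sigma.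
  rewrite -(ler_pXn2r (n := 2))// ?nnegrE ?wt_ge0//.
  apply: le_trans (sum_wt_sqr w s0 fr).
  rewrite (bigD1 j)//= lerDl; apply: sumr_ge0 => i _; exact: sqr_ge0.
pose P := \prod_(w <- s) (2 * enorm w / sigma).
apply: (@le_trans _ _ (\sum_(j < T) (wt u w1 j * wt u w2 j) * P)).
  apply: ler_sum => j _; rewrite !big_cons mulrA.
  apply: ler_wpM2l; first by rewrite mulr_ge0 ?wt_ge0.
  apply: ler_prod => w _; by rewrite wt_ge0 wb.
rewrite -mulr_suml !big_cons mulrA; apply: ler_wpM2r.
  by apply: prodr_ge0 => w _.
by apply: sum_cauchy_schwarz => //; exact: sum_wt_sqr.
Qed.

Lemma dchain_bound T c (C : R) u (sigma : R) w1 w2 s x k :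
  0 < sigma -> frame T (sigma ^- 2) u ->
  (forall j, `|c j| <= C) -> k = (size s).+2 ->
  `|dchain T c u [:: w1, w2 & s] x| <=
    C * (4 * gate_amp * (2 ^+ k * (2 * k)`!%:R)) *
    \prod_(w <- [:: w1, w2 & s]) (2 * enorm w / sigma).
Proof.
move=> s0 fr hc ->{k}; set K := 4 * _ * _.
have C0 : 0 <= C := le_trans (normr_ge0 _) (hc 0%N).
have K0 : 0 <= K := link_const_ge0 _.
apply: (le_trans (ler_norm_sum _ _ _)).
apply: (@le_trans _ _ (\sum_(j < T) C * K * \prod_(w <- [:: w1, w2 & s]) wt u w j)).
  apply: ler_sum => j _; rewrite normrM -mulrA; apply: ler_pM => //.
  exact: dchain1_bound.
rewrite -mulr_sumr; apply: ler_wpM2l; first exact: mulr_ge0.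
exact: sum_prod_wt.
Qed.

(** The mean value theorem along a segment. *)
Lemma segment_mvt (h : 'rV[R]_d -> R) x y :
  (forall z, differentiable h z) ->
  exists z, h x - h y = 'D_(x - y) h z.
Proof.
move=> dh; pose phi (t : R) := h (y + t *: (x - y)).
have dphi (t : R) : is_derive t 1 phi ('D_(x - y) h (y + t *: (x - y))).
  have E : (fun k : R => k^-1 *: ((phi \o shift t) (k *: 1) - phi t)) =
    (fun k : R => k^-1 *: ((h \o shift (y + t *: (x - y))) (k *: (x - y))
                           - h (y + t *: (x - y)))).
    apply/funext => k; rewrite /phi /=; congr (_ *: (h _ - _)).
    have -> : k *: (1 : R) = k by exact: mulr1.
    by rewrite scalerDl addrCA.
  have D : derivable h (y + t *: (x - y)) (x - y) by exact: diff_derivable.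
  apply: DeriveDef; first by rewrite /derivable E.
  by rewrite {1}/derive E.
have cphi : {within `[0, 1], continuous phi}.
  apply: continuous_subspaceT => t; apply: differentiable_continuous.
  by apply/derivable1_diffP; case: (dphi t).
have [t _ E] := MVT ltr01 (fun t _ => dphi t) cphi.
exists (y + t *: (x - y)); move: E.
by rewrite /phi scale1r scale0r addr0 [y + _]addrC subrK subr0 mulr1.
Qed.

Lemma opnorm_dchain_lipschitz T c (C : R) u (sigma : R) p x y :
  (0 < p)%N -> 0 < sigma -> frame T (sigma ^- 2) u ->
  (forall j, `|c j| <= C) ->
  (opnorm (fun v : p.-tuple 'rV[R]_d =>
      (nabla (dchain T c u [::]) x v - nabla (dchain T c u [::]) y v)%R)
   <= (C * (4 * gate_amp * (4 ^+ p.+1 * (2 * p.+1)`!%:R)) / sigma ^+ p.+1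
       * enorm (x - y))%:E)%E.
Proof.
move=> p0 s0 fr hc; apply: ge_ereal_sup => _ [v /= hv <-].
have C0 : 0 <= C := le_trans (normr_ge0 _) (hc 0%N).
rewrite lee_fin !nabla_dchain.
have [z ->] := @segment_mvt (dchain T c u v) x y
  (fun z => (dchain_diff T c u v z 0).1).
rewrite (dchain_diff T c u v z (x - y)).2.
case: v hv => -[|w s] /= sz hv; first by rewrite -(eqP sz) in p0.
have szE : p.+1 = (size s).+2 by rewrite -(eqP sz).
apply: (le_trans (dchain_bound (x - y) w z s0 fr hc szE)).
have hw w' : w' \in (w :: s) -> enorm w' <= 1.
  move=> ws; have [i ->] := tnthP (Tuple (tval := w :: s) sz) w' ws.
  exact: hv.
rewrite big_cons.
have hp : \prod_(w' <- w :: s) (2 * enorm w' / sigma) <= (2 / sigma) ^+ p.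
  have -> : (2 / sigma) ^+ p = \prod_(w' <- w :: s) (2 / sigma).
    by rewrite big_const_seq count_predT iter_mulr_1 -(eqP sz).
  rewrite big_seq [X in _ <= X]big_seq; apply: ler_prod => w' /hw h.
  apply/andP; split.
    by rewrite divr_ge0 ?mulr_ge0 ?enorm_ge0// ltW.
  rewrite ler_pM2r ?invr_gt0// -[X in _ <= X]mulr1.
  exact: ler_wpM2l.
set Q := \prod_(_ <- _) _ in hp *.
have -> : C * (4 * gate_amp * (4 ^+ p.+1 * (2 * p.+1)`!%:R)) / sigma ^+ p.+1
       * enorm (x - y) =
   C * (4 * gate_amp * (2 ^+ p.+1 * (2 * p.+1)`!%:R)) *
   (2 * enorm (x - y) / sigma * (2 / sigma) ^+ p).
  have -> : 4 = 2 * 2 :> R by rewrite -natrM.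
  rewrite exprMn expr_div_n !exprS; field.
  by rewrite ?expf_neq0 gt_eqF.
apply: ler_wpM2l; first exact/mulr_ge0/link_const_ge0.
by apply: ler_wpM2l => //; rewrite !mulr_ge0 ?enorm_ge0 ?invr_ge0// ltW.
Qed.

End Lipschitz.

(** * The gradient and the optimality gap of a chain *)

Section Gradient.
Context {R : realType} {d : nat}.
Implicit Types (u : nat -> 'rV[R]_d) (x y w : 'rV[R]_d) (s : seq 'rV[R]_d).

(** A point whose last chain coordinate vanishes has a large gradient: there is
    a first coordinate [j.+1] of absolute value less than 1, and moving along
    [u j.+1] changes the [j]-th link at a rate that no other link cancels. *)
Lemma opnorm_grad_dchain T (kappa sigma : R) u x :
  (0 < T)%N -> 0 < kappa -> 0 < sigma -> frame T (sigma ^- 2) u ->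
  dot (u T) x = 0 ->
  ((2 * kappa / sigma)%:E <=
   opnorm (@nabla R d 1 (dchain T (fun=> kappa) u [::]) x))%E.
Proof.
move=> T0 k0 s0 [u0 orth] hT.
have sn0 : sigma != 0 by rewrite gt_eqF.
have exj : exists j, `|coord u j.+1 x| < 1.
  by exists T.-1; rewrite prednK// /coord hT addr0 gtn_eqF// normr0.
pose j := ex_minn exj.
have [jT cj1 cj] : [/\ (j < T)%N, `|coord u j.+1 x| < 1 & 1 <= `|coord u j x|].
  rewrite /j; case: ex_minnP => i hi mini; split=> //.
    rewrite -[T]prednK// ltnS; apply: mini.
    by rewrite prednK// /coord hT addr0 gtn_eqF// normr0.
  case: i hi mini => [|i] hi mini.
    by rewrite /coord u0 dot0l addr0 normr1.
  by rewrite leNgt; apply/negP => /mini; rewrite ltnn.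
pose v := sigma *: u j.+1.
have vu i : (i < T)%N -> dot (u i.+1) v = (i == j)%:R / sigma.
  move=> iT; rewrite /v dotZ orth//; case: eqP => _; last by rewrite !mul0r mulr0.
  by field.
have ev : enorm v = 1.
  apply/eqP; rewrite -(@eqrXn2 _ 2)// ?enorm_ge0// enorm_sqr expr1n.
  by rewrite {1}/v dotC dotZ dotC vu// eqxx mul1r mulfV.
have vu0 i : (i < T)%N -> dot (u i) v = (i == j.+1)%:R / sigma.
  by case: i => [_|i iT]; [rewrite u0 dot0l mul0r|rewrite vu// ltnW].
have H : dchain T (fun=> kappa) u [:: v] x <= - (2 * kappa / sigma).
  rewrite /dchain (bigD1 (Ordinal jT))//=.
  rewrite vu0// vu// eqxx ltn_eqF// !mul0r add0r.
  rewrite -[X in _ <= X]addr0; apply: lerD.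
    have -> : - (2 * kappa / sigma) = kappa * (1 / sigma * - 2) by ring.
    rewrite ler_pM2l// ler_pM2l ?divr_gt0//.
    exact: dlink01_le.
  apply: sumr_le0 => i ij; rewrite pmulr_rle0//.
  rewrite vu0// vu// (_ : (i == j :> nat) = false) ?mul0r ?addr0.
    by rewrite mulr_ge0_le0 ?dlink10_le0// divr_ge0// ltW.
  by apply: contraNF ij => /eqP e; apply/eqP/val_inj.
apply: le_ereal_sup_tmp.
exists (`|nabla (dchain T (fun=> kappa) u [::]) x [tuple v]|)%:E.
  by exists [tuple v] => //= i; rewrite (ord1 i) tnth0 ev.
by rewrite nabla_dchain lee_fin ler_normr lerNr H orbT.
Qed.

Lemma dchain_gap T (kappa : R) u (D : R) :
  (0 <= kappa) -> u 0%N = 0 -> 2 * gate_amp * kappa * T%:R <= D ->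
  ((dchain T (fun=> kappa) u [::] 0)%:E
   - ereal_inf [set (dchain T (fun=> kappa) u [::] x)%:E | x in setT]
   <= D%:E)%E.
Proof.
move=> k0 u0 hD.
have F0 : dchain T (fun=> kappa) u [::] 0 <= 0.
  apply: sumr_le0 => j _; rewrite mulr_ge0_le0//= /coord !linear0 !addr0.
  case: (nat_of_ord j) => [|i]; first exact: link1_le0.
  by rewrite dlink_eq0// normr0 invr_ge0.
have Fx x : - D <= dchain T (fun=> kappa) u [::] x.
  apply: (@le_trans _ _ (\sum_(j < T) kappa * - (2 * gate_amp))).
    rewrite sumr_const card_ord -mulr_natr -mulNr in hD *.
    move: hD; set t := T%:R; lra.
  by apply: ler_sum => j _; apply: ler_wpM2l => //; exact: link_ge.
have -> : D%:E = (0%:E - (- D)%:E)%E :> \bar R by rewrite -EFinB sub0r opprK.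
apply: leeB; first by rewrite lee_fin.
by apply: le_ereal_inf_tmp => _ [x _ <-]; rewrite lee_fin.
Qed.

End Gradient.

(** * The resisting oracle *)

Section Resisting.
Context {R : realType}.

(** The coordinates of [v] form a nonzero vector in the kernel of the matrix
    with columns [s]. *)
Lemma exists_orthogonal d (s : seq 'rV[R]_d) (sigma : R) : 0 < sigma ->
  (size s < d)%N ->
  exists v : 'rV[R]_d, dot v v = sigma ^- 2 /\ forall x, x \in s -> dot v x = 0.
Proof.
move=> s0 sd.
pose V : 'M[R]_(d, size s) := \matrix_(i, j) nth 0 s j 0 i.
have kV : kermx V != 0.
  rewrite -mxrank_eq0 mxrank_ker subn_eq0 -ltnNge.
  exact: leq_ltn_trans (rank_leq_col _) sd.
have /rowV0Pn[v /sub_kermxP vV v0] := kV.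
have nv0 : enorm v != 0.
  apply: contra v0 => /eqP e0; apply/eqP/rowP => i; rewrite mxE.
  have := enorm_sqr v; rewrite e0 expr0n => /esym h.
  have hp j : true -> 0 <= v 0 j * v 0 j by rewrite -expr2 sqr_ge0.
  by have /eqP := psumr_eq0P hp h (i := i) isT; rewrite mulf_eq0 orbb => /eqP.
exists ((sigma * enorm v)^-1 *: v); split.
  by rewrite dotZ dotC dotZ -enorm_sqr; field; rewrite nv0 gt_eqF.
move=> x xs; rewrite dotC dotZ dotC.
have xi : (index x s < size s)%N by rewrite index_mem.
have h : (v *m V) 0 (Ordinal xi) = 0 by rewrite vV mxE.
suff -> : dot v x = 0 by rewrite mulr0.
rewrite -h mxE; apply: eq_bigr => i _.
by rewrite mxE /= nth_index.
Qed.

Lemma exists_avoiding (T : finType) (Q : {set T}) m : (m + #|Q| <= #|T|)%N ->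
  exists S : {set T}, #|S| = m /\ forall i, i \in Q -> i \notin S.
Proof.
move=> h; exists [set x in take m (enum (~: Q))]; split.
  rewrite cardsE (card_uniqP _) ?take_uniq ?enum_uniq// size_takel//.
  by rewrite -cardE -(leq_add2r #|Q|) [(#|~: Q| + _)%N]addnC cardsC.
move=> i iQ; rewrite inE; apply/negP => /mem_take.
by rewrite mem_enum inE iQ.
Qed.

Section Run.
Context {n q : nat} (A : algorithm R n q) (xi : R) {d : nat}.
Implicit Types (f : 'I_n -> 'rV[R]_d -> R) (u : nat -> 'rV[R]_d)
  (S : nat -> {set 'I_n}).

(** The [t]-th query of the run on [f]. *)
Definition ask f t := query A xi (transcript A f xi t).

Lemma eq_transcript f f' t :
  (forall s, (s < t)%N -> oracle (q := q) f (ask f s).1 (ask f s).2 =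
                          oracle f' (ask f s).1 (ask f s).2) ->
  transcript A f xi t = transcript A f' xi t.
Proof.
elim: t => //= t IH h.
have e : transcript A f xi t = transcript A f' xi t.
  by apply: IH => s st; apply: h; exact: ltnW.
by rewrite -e (h t).
Qed.

(** Link [j] is present, with weight [lam], in the components of [S j] only. *)
Definition fam T lam u S (i : 'I_n) : 'rV[R]_d -> R :=
  dchain T (fun j => lam * (i \in S j)%:R) u [::].

Lemma eq_fam T lam u u' S S' :
  (forall j, (j <= T)%N -> u j = u' j) ->
  (forall j, (j < T)%N -> S j = S' j) ->
  fam T lam u S = fam T lam u' S'.
Proof.
move=> eu eS; apply/funext => i; apply/funext => x.
apply: eq_bigr => j _; rewrite eS//; congr (_ * _).
by apply: eq_dchain1; apply: eu => //; exact: ltnW.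
Qed.

(** A query does not see the last link if its component lacks that link, or if
    the gate of that link is closed at its iterate. *)
Lemma oracle_famS T lam u S i x :
  i \notin S T \/ ((0 < T)%N /\ dot (u T) x = 0) ->
  oracle (q := q) (fam T lam u S) i x = oracle (fam T.+1 lam u S) i x.
Proof.
move=> h; apply: functional_extensionality_dep => k; apply/funext => v.
rewrite /oracle /fam !nabla_dchain /dchain big_ord_recr /=.
rewrite [X in _ = _ + X](_ : _ = 0) ?addr0//.
case: h => [/negbTE ->|[T0 h]]; first by rewrite mulr0 mul0r.
rewrite dchain1_eq0 ?mulr0// /coord h gtn_eqF// addr0 normr0.
by rewrite invr_ge0.
Qed.

(** Against a deterministic algorithm, each block of [N] queries reveals at most
    one link: the set [S k] avoids the first [N - 1] components asked in block
    [k], and the vector [u k.+1] is orthogonal to all iterates up to the end of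
    that block. *)
Lemma resisting_oracle (lam sigma : R) m N T : 0 < sigma ->
  (m + N = n.+1)%N -> (0 < N)%N -> (T * N.+1 <= d)%N ->
  forall k, (k <= T)%N -> exists u S,
    [/\ frame k (sigma ^- 2) u, forall j, (j < k)%N -> #|S j| = m &
        forall t, (t < k * N)%N -> dot (u k) (iterate A (fam k lam u S) xi t) = 0].
Proof.
move=> s0 mN N0 Td; elim=> [_|k IH kT].
  by exists (fun=> 0), (fun=> finset.set0); split.
have [u [S [[u0 orth] cS hit]]] := IH (ltnW kT).
set f := fam k lam u S in hit.
pose Q := [set (ask f (k * N + s)).1 | s : 'I_N.-1].
have [Sk [cSk Skav]] : exists Sk : {set 'I_n},
    #|Sk| = m /\ forall i, i \in Q -> i \notin Sk.
  apply: exists_avoiding; rewrite card_ord -ltnS -mN ltn_add2l.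
  apply: (@leq_ltn_trans N.-1); last by rewrite prednK.
  by apply: leq_trans (leq_imset_card _ _) _; rewrite card_ord.
(* The new vector is orthogonal to the iterates [xs] and the old vectors [us]. *)
pose xs := [seq iterate A f xi t | t <- iota 0 (k.+1 * N)].
pose us := [seq u j.+1 | j <- iota 0 k].
have [v [vv vorth]] : exists v : 'rV[R]_d,
    dot v v = sigma ^- 2 /\ forall x, x \in us ++ xs -> dot v x = 0.
  apply: exists_orthogonal => //; rewrite size_cat !size_map !size_iota.
  by apply: leq_trans Td; rewrite -addSn -mulnS leq_mul2r kT orbT.
have vx t : (t < k.+1 * N)%N -> dot v (iterate A f xi t) = 0.
  move=> tk; apply: vorth; rewrite mem_cat; apply/orP; right.
  by apply/mapP; exists t => //; rewrite mem_iota.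
have vu j : (j < k)%N -> dot v (u j.+1) = 0.
  move=> jk; apply: vorth; rewrite mem_cat; apply/orP; left.
  by apply/mapP; exists j => //; rewrite mem_iota.
pose u' j := if j == k.+1 then v else u j.
pose S' j := if j == k then Sk else S j.
have u'E j : (j <= k)%N -> u' j = u j by move=> jk; rewrite /u' ltn_eqF.
have ef : f = fam k lam u' S'.
  by apply: eq_fam => j jk; rewrite ?u'E// /S' ltn_eqF.
exists u', S'; split.
- split=> [|i j]; first by rewrite u'E.
  rewrite !ltnS [(i <= k)%N]leq_eqVlt [(j <= k)%N]leq_eqVlt.
  move=> /orP[/eqP->|ik] /orP[/eqP->|jk].
  + by rewrite /u' !eqxx mul1r.
  + by rewrite {1}/u' eqxx u'E// vu// gtn_eqF// mul0r.
  + by rewrite {2}/u' eqxx u'E// dotC vu// ltn_eqF// mul0r.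
  + by rewrite !u'E// orth.
- move=> j; rewrite ltnS [(j <= k)%N]leq_eqVlt /S' => /orP[/eqP->|jk].
    by rewrite eqxx.
  by rewrite ltn_eqF// cS.
- move=> t tk; rewrite {1}/u' eqxx.
  suff -> : iterate A (fam k.+1 lam u' S') xi t = iterate A f xi t by exact: vx.
  rewrite /iterate -(@eq_transcript f)// => s st; rewrite {1}ef; apply: oracle_famS.
  (* Before block [k] the gate of link [k] is closed; in block [k], except at its
     last query, the component asked lacks link [k]. *)
  have [sk|ks] := ltnP s (k * N).
    right; split; first by case: (k) sk.
    by rewrite u'E//; exact: hit.
  left; rewrite /S' eqxx; apply: Skav; apply/imsetP.
  have sN : (s - k * N < N.-1)%N.
    by rewrite mulSn in tk; lia.
  by exists (Ordinal sN) => //=; rewrite subnKC.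
Qed.

End Run.

Lemma average_fam n d T (lam : R) m (u : nat -> 'rV[R]_d) (S : nat -> {set 'I_n}) :
  (forall j, (j < T)%N -> #|S j| = m) ->
  average (fam T lam u S) = dchain T (fun=> lam * (m%:R / n%:R)) u [::].
Proof.
move=> cS; apply/funext => x; rewrite /average /fam /dchain exchange_big /=.
rewrite mulr_sumr; apply: eq_bigr => j _.
rewrite -mulr_suml mulrA; congr (_ * _).
rewrite -mulr_sumr -(cS j)// -natr_sum.
have -> : (\sum_(i < n) (i \in S j))%N = #|S j|.
  by rewrite -sum1_card [RHS]big_mkcond /=; apply: eq_bigr => i _; case: ifP.
by rewrite mulrC mulrA.
Qed.

End Resisting.

(** * Scaling and constants *)

Section Scaling.
Context {R : realType}.

(** Twice a Lipschitz constant for the [p]-th derivative of an unscaled chain;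
    the factor 2 absorbs the one in the weight [2 * eps * sigma] of the links. *)
Definition hard_ell (p : nat) : R :=
  8 * gate_amp * (4 ^+ p.+1 * (2 * p.+1)`!%:R).

Lemma hard_ell_gt0 p : 0 < hard_ell p.
Proof.
apply: mulr_gt0; first by rewrite mulr_gt0 ?gate_amp_gt0.
by rewrite mulr_gt0 ?exprn_gt0// ltr0n fact_gt0.
Qed.

Lemma fact_le_expn k : (k`! <= k ^ k)%N.
Proof.
elim: k => // k IH; rewrite factS expnS leq_mul2l; apply/orP; right.
case: k IH => // k IH; apply: (leq_trans IH).
by rewrite leq_exp2r.
Qed.

(** [(2 p + 2)!] is at most [(4 p) ^ (2 p + 2)], hence of order
    [exp (2 p ln p + O(p))]. *)
Lemma hard_ell_le p : (1 <= p)%N ->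
  hard_ell p <= expR (5 / 2 * p%:R * ln p%:R + (8 * gate_amp + 2 * ln 16 + 8) * p%:R).
Proof.
move=> p1; have p0 : 0 < p%:R :> R by rewrite ltr0n.
have p1R : 1 <= p%:R :> R by rewrite ler1n.
have lnp : 0 <= ln (p%:R : R) by rewrite ln_ge0.
have e_ge (x : R) : 0 <= x -> x <= expR x.
  by move=> x0; apply: le_trans (expR_ge1Dx x); rewrite lerDr.
have g0 : 0 < gate_amp :> R := gate_amp_gt0.
have h1 : 8 * gate_amp <= expR (8 * gate_amp * p%:R) :> R.
  apply: (le_trans (e_ge _ _)); first by rewrite mulr_ge0// ltW.
  by rewrite ler_expR ler_peMr// mulr_ge0// ltW.
have h16 : (16 : R) ^+ p = expR (ln 16 * p%:R).
  by rewrite expRM_natr lnK// posrE.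
have h2 : 4 ^+ p.+1 <= expR (ln 16 * p%:R) :> R.
  rewrite -h16; have -> : 16 = 4 ^+ 2 :> R by rewrite -natrX.
  by rewrite -exprM ler_weXn2l ?ler1n// mul2n -addnn -addn1 leq_add2l.
have h3 : (2 * p.+1)`!%:R <= expR (ln 16 * p%:R) * expR (2 * p%:R * ln p%:R)
    * expR (8 * p%:R) :> R.
  apply: (@le_trans _ _ ((4 * p%:R) ^+ (2 * p.+1))).
    rewrite -natrM -natrX ler_nat; apply: (leq_trans (fact_le_expn _)).
    by rewrite leq_exp2r ?muln_gt0//; lia.
  have -> : (2 * p.+1 = 2 * p + 2)%N by rewrite mulnS addnC.
  rewrite exprD.
  have -> : (4 * p%:R : R) ^+ (2 * p) = expR (ln 16 * p%:R) * expR (2 * p%:R * ln p%:R).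
    rewrite -h16 exprMn [in X in X * _ = _]exprM; congr (_ ^+ _ * _).
      by rewrite -natrX.
    by rewrite -natrM expRM_natl lnK// posrE.
  apply: ler_wpM2l; first by rewrite mulr_ge0// expR_ge0.
  have -> : 8 * p%:R = 4 * p%:R * 2%:R :> R by ring.
  rewrite expRM_natr.
  by rewrite lerXn2r ?nnegrE ?expR_ge0 ?mulr_ge0 ?ler0n ?e_ge.
apply: (@le_trans _ _ (expR (8 * gate_amp * p%:R) * (expR (ln 16 * p%:R) *
   (expR (ln 16 * p%:R) * expR (2 * p%:R * ln p%:R) * expR (8 * p%:R))))).
  rewrite /hard_ell; apply: ler_pM => //.
  - by rewrite mulr_ge0// ltW.
  - exact: ler_pM.
rewrite -!expRD ler_expR.
have : 0 <= p%:R * ln p%:R :> R by rewrite mulr_ge0// ltW.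
lra.
Qed.

(** The length scale [sigma] solves [eps * ell / sigma ^ p = Lp], and then the
    rate is [Delta * n / (eps * sigma)]. *)
Definition scale p (Lp eps ell : R) : R := (eps * ell / Lp) `^ (p%:R^-1).

Lemma scale_gt0 p Lp eps ell : 0 < Lp -> 0 < eps -> 0 < ell -> 0 < scale p Lp eps ell.
Proof. by move=> *; rewrite powR_gt0// divr_gt0// mulr_gt0. Qed.

Lemma scaleX p Lp eps ell : (1 <= p)%N -> 0 < Lp -> 0 < eps -> 0 < ell ->
  scale p Lp eps ell ^+ p = eps * ell / Lp.
Proof.
move=> p1 L0 e0 l0; rewrite -powR_mulrn ?powR_ge0// -powRrM mulVf ?powRr1//.
  by rewrite divr_ge0 ?mulr_ge0// ltW.
by rewrite pnatr_eq0 -lt0n.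
Qed.

Lemma rate_scale p n Delta Lp eps ell :
  (1 <= p)%N -> 0 < Lp -> 0 < eps -> 0 < ell ->
  rate p n Delta Lp eps ell = Delta * n%:R / (eps * scale p Lp eps ell).
Proof.
move=> p1 L0 e0 l0; rewrite /rate /scale.
have pn0 : p%:R != 0 :> R by rewrite pnatr_eq0 -lt0n.
have -> : p.+1%:R / p%:R = 1 + p%:R^-1 :> R by rewrite -natr1; field.
rewrite powRD; last by rewrite (gt_eqF e0) implybT.
rewrite powRr1 ?ltW//; set s := p%:R^-1.
have -> : (eps * ell / Lp) `^ s = eps `^ s * (ell / Lp) `^ s.
  by rewrite -powRM ?divr_ge0 ?ltW// mulrA.
have inv : (Lp / ell) `^ s * (ell / Lp) `^ s = 1.
  rewrite -powRM ?divr_ge0 ?ltW//.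
  have -> : Lp / ell * (ell / Lp) = 1 by field; rewrite !gt_eqF.
  by rewrite powR1.
have a0 : (ell / Lp) `^ s != 0 by rewrite gt_eqF// powR_gt0// divr_gt0.
have b0 : eps `^ s != 0 by rewrite gt_eqF// powR_gt0.
have -> : (Lp / ell) `^ s = ((ell / Lp) `^ s)^-1.
  by rewrite -[LHS]mulr1 -(mulfV a0) mulrA inv mul1r.
by field; rewrite a0 b0 gt_eqF.
Qed.

End Scaling.

(** * The lower bound *)

(** For a fixed seed, the bad event has probability 0 or 1. *)
Lemma complexity_ge (R : realType) d n q (eps xi : R) (A : algorithm R n q)
    (f : 'I_n -> 'rV[R]_d -> R) t0 :
  seed A = Fixed xi ->
  (forall s, (s < t0)%N ->
     (eps%:E < opnorm (@nabla R d 1 (average f) (iterate A f xi s)))%E) ->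
  ((t0%:R)%:E <= complexity eps A f)%E.
Proof.
move=> sA big; apply: le_ereal_inf_tmp => _ [t /= ht <-].
rewrite lee_fin ler_nat leqNgt; apply/negP => tt0; move: ht.
rewrite sA /= diracE mem_set => [|s st]; last by apply: big; exact: leq_ltn_trans tt0.
by rewrite lee_fin leNgt invf_lt1 ?ltr1n.
Qed.

(** Any number [T] of links that [Delta] can pay for yields a lower bound of [T]
    blocks of [n / 2 + 1] queries; [T] vectors and [T * (n / 2 + 1)] iterates
    determine the dimension. *)
Lemma hard_instance (R : realType) p q n (A : algorithm R n q)
    (Delta Lp eps ell xi : R) T :
  (1 <= p)%N -> (1 <= n)%N -> seed A = Fixed xi ->
  0 < Lp -> 0 < eps -> ell = hard_ell p ->
  let sigma := scale p Lp eps ell in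
  (0 < T)%N -> 4 * gate_amp * eps * sigma * T%:R <= Delta ->
  exists f : 'I_n -> 'rV[R]_(T * n./2.+2) -> R,
    [/\ function_class p Delta Lp f,
        forall i, times_differentiable q (f i) &
        (((T * n./2.+1)%N%:R)%:E <= complexity eps A f)%E].
Proof.
move=> p1 n1 sA L0 e0 ellE sigma T0 hD.
have l0 : 0 < ell by rewrite ellE hard_ell_gt0.
have s0 : 0 < sigma by exact: scale_gt0.
pose lam := 2 * eps * sigma; pose m := (n - n./2)%N.
have lam0 : 0 < lam by rewrite !mulr_gt0.
have n0 : 0 < n%:R :> R by rewrite ltr0n.
have mN : (m + n./2.+1 = n.+1)%N by rewrite /m; lia.
have [u [S [fr cS hit]]] :=
  @resisting_oracle R n q A xi (T * n./2.+2) lam sigma m n./2.+1 T s0 mN isT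
    (leqnn _) T (leqnn T).
pose kappa := lam * (m%:R / n%:R).
have avE : average (fam T lam u S) = dchain T (fun=> kappa) u [::].
  exact: average_fam.
have mn : 2^-1 <= m%:R / n%:R :> R.
  rewrite ler_pdivlMr// mulrC ler_pdivrMr// -natrM ler_nat /m.
  lia.
have k0 : 0 < kappa by rewrite mulr_gt0// (lt_le_trans _ mn)// invr_gt0.
have klam : kappa <= lam.
  rewrite /kappa ler_piMr//; first exact: ltW.
  by rewrite ler_pdivrMr// mul1r ler_nat leq_subr.
exists (fam T lam u S); split.
- split=> [i|]; last first.
    rewrite avE; apply: dchain_gap; [exact: ltW|exact: fr.1|].
    apply: le_trans hD.
    have -> : 4 * gate_amp * eps * sigma * T%:R = 2 * gate_amp * lam * T%:R.
      by rewrite /lam; ring.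
    apply: ler_wpM2r => //; apply: ler_wpM2l => //.
    by apply: mulr_ge0 => //; exact: ltW gate_amp_gt0.
  split; first exact: times_continuously_differentiable_dchain.
  move=> x y; apply: (le_trans (opnorm_dchain_lipschitz (C := lam) x y p1 s0 fr _)).
    move=> j; case: (i \in S j); rewrite ?mulr1 ?mulr0 ?normr0 ?gtr0_norm//.
    exact: ltW.
  rewrite lee_fin; apply: ler_wpM2r; first exact: enorm_ge0.
  have -> : lam * (4 * gate_amp * (4 ^+ p.+1 * (2 * p.+1)`!%:R)) = eps * sigma * ell.
    by rewrite ellE /lam /hard_ell; ring.
  rewrite exprS /sigma scaleX//.
  rewrite (_ : _ / _ = Lp)//; field.
  by rewrite !gt_eqF.
- move=> i; exact: times_differentiable_dchain.
- apply: complexity_ge sA _ => s sT; rewrite avE.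
  apply: lt_le_trans (opnorm_grad_dchain T0 k0 s0 fr (hit s sT)).
  rewrite lte_fin /kappa /lam.
  have -> : 2 * (2 * eps * sigma * (m%:R / n%:R)) / sigma = 4 * eps * (m%:R / n%:R).
    by field; rewrite !gt_eqF.
  nra.
Qed.

(* C is the constant of Omega, [D1, D2] those of "same order"; K delimits the
   regime of Omega: for large eps / small Delta every F in the class has
   |grad F(0)| <= eps, so the complexity is 0 while the rate, being
   proportional to n, may be large. *)
Theorem theorem3p6 (R : realType) :
  exists (C K D1 D2 c : R) (ell : nat -> R),
    [/\ 0 < C, 0 < K, 0 < D1 & 0 < D2] /\
    (forall p : nat, (1 <= p)%N ->
       0 < ell p /\
       ell p <= expR (5 / 2 * p%:R * ln p%:R + c * p%:R)) /\
    (forall (p q n : nat) (A : algorithm R n q) (Delta Lp eps : R),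
       (1 <= p)%N -> (1 <= n)%N -> deterministic A ->
       0 < Delta -> 0 < Lp -> 0 < eps ->
       K * n%:R <= rate p n Delta Lp eps (ell p) ->
       exists (d : nat) (f : 'I_n -> 'rV[R]_d -> R),
         [/\ function_class p Delta Lp f,
             (forall i, times_differentiable q (f i)),
             ((C * rate p n Delta Lp eps (ell p))%:E
                <= complexity eps A f)%E &
             D1 * rate p n Delta Lp eps (ell p) <= d%:R
                <= D2 * rate p n Delta Lp eps (ell p)]).
Proof.
have [M ME M0] : exists2 M : R, gate_amp = M & 0 < M.
  by exists gate_amp => //; exact: gate_amp_gt0.
exists (16 * M)^-1, (4 * M), (16 * M)^-1, (3 / (4 * M)), (8 * gate_amp + 2 * ln 16 + 8).
exists hard_ell; split.
  have M16 : 0 < 16 * M by rewrite mulr_gt0.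
  have M4 : 0 < 4 * M by rewrite mulr_gt0.
  by split; rewrite ?invr_gt0 ?divr_gt0.
split=> [p p1|p q n A Delta Lp eps p1 n1 [xi sA] D0 L0 e0].
  by split; [exact: hard_ell_gt0|exact: hard_ell_le].
have half1 : (n <= n./2.+1 * 2)%N by lia.
have half2 : (n./2.+2 <= 3 * n)%N by lia.
have l0 := @hard_ell_gt0 R p.
rewrite rate_scale//; set sigma := scale _ _ _ _.
have s0 : 0 < sigma by exact: scale_gt0.
have n0 : 0 < n%:R :> R by rewrite ltr0n.
set r := Delta * n%:R / (eps * sigma) => hK.
have r0 : 0 < r by apply: divr_gt0; apply: mulr_gt0.
(* [z] is the number of links that the budget Delta pays for. *)
pose z := r / (4 * M * n%:R).
have rE : r = 4 * M * n%:R * z by rewrite /z; field; rewrite !gt_eqF.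
have Mn0 : 0 < 4 * M * n%:R by rewrite !mulr_gt0.
have z1 : 1 <= z by rewrite /z (ler_pdivlMr _ _ Mn0) mul1r.
pose T := Num.trunc z.
have T0 : (0 < T)%N by rewrite truncn_gt0.
have T1 : 1 <= T%:R :> R by rewrite ler1n.
have Tz : T%:R <= z by rewrite truncn_le (le_trans ler01).
have zT : z < T%:R + 1 by rewrite natr1 truncnS_gt.
have zT2 : z / 2 <= T%:R by lra.
have hD : 4 * gate_amp * eps * sigma * T%:R <= Delta.
  have -> : Delta = 4 * gate_amp * eps * sigma * z.
    by rewrite ME /z /r; field; rewrite !gt_eqF.
  by rewrite ME; apply: ler_wpM2l => //; rewrite !mulr_ge0// ltW.
have [f [f1 f2 f3]] := @hard_instance R p q n A Delta Lp eps _ xi T p1 n1 sA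
  L0 e0 erefl T0 hD.
have half1R : n%:R / 2 <= (n./2.+1)%:R :> R.
  by rewrite ler_pdivrMr// -natrM ler_nat.
have half2R : (n./2.+2)%:R <= 3 * n%:R :> R by rewrite -natrM ler_nat.
have TN : (16 * M)^-1 * r <= (T * n./2.+1)%N%:R.
  have -> : (16 * M)^-1 * r = z / 2 * (n%:R / 2).
    by rewrite rE; field; rewrite !gt_eqF.
  by rewrite natrM; apply: ler_pM => //; rewrite divr_ge0// ltW// (lt_le_trans ltr01).
exists (T * n./2.+2)%N, f; split=> //.
  by apply: le_trans f3; rewrite lee_fin.
apply/andP; split.
  by apply: (le_trans TN); rewrite ler_nat leq_mul2l leqnSn orbT.
have -> : 3 / (4 * M) * r = z * (3 * n%:R).
  by rewrite rE; field; rewrite !gt_eqF.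
by rewrite natrM; apply: ler_pM.
Qed.
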